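(* Let $W$ be a Coxeter group with Bruhat order, let $n\ge1$, and fix the data $I_k$ and $\varphi_{[x,y]}$ (for all $k<n$ and all intervals $[x,y]$ of length $k<n$) described in the context. Let $[u,v]$ and $[u',v']$ be Bruhat intervals of length $n$ in $W$ that are isomorphic as posets. Then there exist enumerations of the coatom sets $\{w\in W\mid u<w\lhd v\}$ and $\{w\in W\mid u'<w\lhd v'\}$ such that $TPA([u,v])=TPA([u',v'])$.
   Context: For $x\le y$ in $W$, the Bruhat interval $[x,y]=\{z\in W\mid x\le z\le y\}$ has length $\ell(y)-\ell(x)$, where $\ell$ is the Coxeter length; $x\lhd y$ means $x<y$ and $\ell(y)=\ell(x)+1$. Data: for each $k<n$, $I_k$ is a set of Bruhat intervals of length $k$ in $W$ containing exactly one representative of each poset-isomorphism class of such intervals, its elements enumerated by natural numbers; for every interval $[x,y]$ of length $k<n$ a poset isomorphism $\varphi_{[x,y]}$ from $[x,y]$ onto an element of $I_k$ is fixed. Construction for an interval $[u,v]$ of length $n$: enumerate its coatoms $\{w\in W\mid u<w\lhd v\}$ as $v_1,\dots,v_m$. Let $T([u,v])$ be the list $(t_1,\dots,t_m)$ where $t_i$ is the number of the element of $I_{n-1}$ isomorphic to $[u,v_i]$. For a tuple $\psi=(\psi_1,\dots,\psi_m)$ with $\psi_i$ a poset automorphism of $[u,v_i]$, put $\Theta_i=\varphi_{[u,v_i]}\circ\psi_i$. Set $P_\psi([u,v])=\{(i,j,\Theta_i(w),\Theta_j(w)) \mid 1\le i<j\le m,\ w\in[u,v],\ w\lhd v_i,\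 w\lhd v_j\}$. For $w\in[u,v]$ with $w\lhd v_i$, there is exactly one other coatom $v_j$ ($j\neq i$) with $w\lhd v_j$; define $\tau^{\psi}_{(u,v),w}=\varphi_{[\Theta_i(u),\Theta_i(w)]}\circ\Theta_i|_{[u,w]}\circ\Theta_j^{-1}|_{\Theta_j([u,w])}\circ\varphi^{-1}_{[\Theta_j(u),\Theta_j(w)]}$, a poset automorphism of the element of $I_{n-2}$ isomorphic to $[u,w]$. Set $A_\psi([u,v])=\{(i,\Theta_i(w),\tau^{\psi}_{(u,v),w})\mid 1\le i\le m,\ w\in[u,v],\ w\lhd v_i\}$. Finally $TPA([u,v])=\{(T([u,v]),P_\psi([u,v]),A_\psi([u,v]))\mid \psi=(\psi_1,\dots,\psi_m),\ \psi_i\in\mathrm{Aut}([u,v_i])\}$; it depends on the chosen enumeration of coatoms. *)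

(* Defs.v *)
From Stdlib Require Import Relation_Operators.
From mathcomp Require Import all_boot.
From mathcomp Require Import boolp classical_sets functions.

Set Implicit Arguments.
Unset Strict Implicit.
Unset Printing Implicit Defensive.

Local Open Scope classical_set_scope.
Local Open Scope group_scope.

(* [W] has the presentation <s_i | (s_i s_j)^m(i,j) = 1>; the value m i j = 0
   encodes m(i,j) = oo, so that the corresponding relation is void.  Words in
   the s_i suffice for generation because s_i^-1 = s_i (as m(i,i) = 1).
   [cox_univ] says that W has no relations beyond the given ones; uniqueness
   of the morphism follows from [cox_gen]. *)
Record coxeterSystem (W : groupType) := CoxeterSystem {
  cox_index : Type;
  cox_s : cox_index -> W;
  cox_m : cox_index -> cox_index -> nat;
  cox_m_diag : forall i, cox_m i i = 1%N;
  cox_m_neq1 : forall i j, i <> j -> cox_m i j <> 1%N;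
  cox_m_sym : forall i j, cox_m i j = cox_m j i;
  cox_rel : forall i j, (cox_s i * cox_s j) ^+ cox_m i j = 1;
  cox_gen : forall w : W, exists r : seq cox_index,
    w = \prod_(i <- r) cox_s i;
  cox_univ : forall (G : groupType) (g : cox_index -> G),
    (forall i j, (g i * g j) ^+ cox_m i j = 1) ->
    exists f : {multiplicative W -> G}, forall i, f (cox_s i) = g i }.

Section Bruhat.
Variables (W : groupType) (C : coxeterSystem W).

Definition is_expr (w : W) (r : seq (cox_index C)) : Prop :=
  w = \prod_(i <- r) cox_s i.

Lemma ex_expr_size (w : W) :
  exists k, `[< exists2 r, is_expr w r & size r = k >].
Proof.
by have [r wr] := cox_gen C w; exists (size r); apply/asboolP; exists r.
Qed.

Definition cox_length (w : W) : nat := ex_minn (ex_expr_size w).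

Definition reflection : set W :=
  [set t | exists w i, t = w * cox_s (c := C) i * w^-1].

Definition bruhat_step (x y : W) : Prop :=
  reflection (x^-1 * y) /\ (cox_length x < cox_length y)%N.

Definition bruhat_le : W -> W -> Prop := clos_refl_trans W bruhat_step.

Definition bruhat_lt (x y : W) : Prop := bruhat_le x y /\ x <> y.

Definition bruhat_cov (x y : W) : Prop :=
  bruhat_lt x y /\ cox_length y = (cox_length x).+1.

Definition itv (x y : W) : set W :=
  [set z | bruhat_le x z /\ bruhat_le z y].

Definition is_itv (k : nat) (x y : W) : Prop :=
  bruhat_le x y /\ cox_length y = (cox_length x + k)%N.

(* Only the restriction of [f] to [A] matters. *)
Definition poset_iso (A B : set W) (f : W -> W) : Prop :=
  set_bij A B f /\
  (forall a b, A a -> A b -> bruhat_le a b <-> bruhat_le (f a) (f b)).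

Definition poset_isomorphic (A B : set W) : Prop :=
  exists f, poset_iso A B f.

Definition poset_aut (A : set W) (f : W -> W) : Prop := poset_iso A A f.

Definition coatoms (u v : W) : set W :=
  [set w | bruhat_lt u w /\ bruhat_cov w v].

Definition coatom_enum (u v : W) (m : nat) (c : 'I_m -> W) : Prop :=
  set_bij [set: 'I_m] (coatoms u v) c.

End Bruhat.

(* An interval [x, y] is recorded as the pair (x, y) of its end points. *)
Record tpaData (W : groupType) (C : coxeterSystem W) (n : nat) := TpaData {
  reps : nat -> set (W * W);
  reps_itv : forall k, (k < n)%N ->
    forall p, reps k p -> is_itv C k p.1 p.2;
  reps_uniq : forall k, (k < n)%N -> forall x y, is_itv C k x y ->
    exists! p, reps k p /\ poset_isomorphic C (itv C x y) (itv C p.1 p.2);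
  num : nat -> W * W -> nat;
  num_inj : forall k, (k < n)%N -> set_inj (reps k) (num k);
  phi : W -> W -> W -> W;
  phi_iso : forall k, (k < n)%N -> forall x y, is_itv C k x y ->
    exists2 p, reps k p & poset_iso C (itv C x y) (itv C p.1 p.2) (phi x y) }.

Definition graph (T : Type) (A : set T) (f : T -> T) : set (T * T) :=
  [set ab | A ab.1 /\ ab.2 = f ab.1].

Section TPA.
Variables (W : groupType) (C : coxeterSystem W) (n : nat) (D : tpaData C n).
Variables (u v : W) (m : nat) (c : 'I_m -> W).

Definition rep_of (k : nat) (x y : W) : W * W :=
  xget (x, y)
    [set p | reps D k p /\ poset_isomorphic C (itv C x y) (itv C p.1 p.2)].

Definition T_list : seq nat :=
  [seq num D n.-1 (rep_of n.-1 u (c i)) | i <- enum 'I_m].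

Definition aut_tuple (psi : 'I_m -> W -> W) : Prop :=
  forall i, poset_aut C (itv C u (c i)) (psi i).

Section Psi.
Variable psi : 'I_m -> W -> W.

Definition Theta (i : 'I_m) : W -> W := phi D u (c i) \o psi i.

Definition P_set : set (nat * nat * W * W) :=
  [set q | exists (i j : 'I_m) (w : W),
    [/\ (i < j)%N, itv C u v w, bruhat_cov C w (c i), bruhat_cov C w (c j) &
        q = (val i, val j, Theta i w, Theta j w)]].

(* Maps between intervals are compared as graphs, so that the values outside
   the intervals of the total functions encoding them play no role;
   in relation_scope, [B \; A] is the composite "A, then B". *)
Definition tau (i j : 'I_m) (w : W) : set (W * W) :=
  (graph (itv C (Theta i u) (Theta i w)) (phi D (Theta i u) (Theta i w)) \;
   (graph (itv C u w) (Theta i) \;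
    ((graph (itv C u w) (Theta j))^-1 \;
     (graph (itv C (Theta j u) (Theta j w))
        (phi D (Theta j u) (Theta j w)))^-1)))%relation.

(* [j] is the only index other than [i] such that [c j] covers [w]. *)
Definition A_set : set (nat * W * set (W * W)) :=
  [set q | exists (i j : 'I_m) (w : W),
    [/\ itv C u v w, bruhat_cov C w (c i), j != i, bruhat_cov C w (c j) &
        q = (val i, Theta i w, tau i j w)]].

End Psi.

Definition TPA : set (seq nat * set (nat * nat * W * W)
                      * set (nat * W * set (W * W))) :=
  [set q | exists2 psi, aut_tuple psi & q = (T_list, P_set psi, A_set psi)].

End TPA.

(* Main.v *)
From HB Require Import structures.
From Stdlib Require Import Relation_Operators Operators_Properties.
Require Import Defs.
From mathcomp Require Import all_boot.
From mathcomp Require Import boolp classical_sets functions.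

(** Given an isomorphism [f] from [[u, v]] to [[u', v']], enumerate the coatoms
    of [[u', v']] as the images [f (c i)] of those of [[u, v]].  The intervals
    [[u, c i]] and [[u', f (c i)]] have the same representative, so every tuple
    of automorphisms [psi] has a counterpart [psi'] with
    [Theta' i (f x) = Theta i x] on [[u, c i]], and then the [T], [P] and [A]
    components agree.

    This needs two facts on the Bruhat order: an element has finitely many
    coatoms, so that they can be enumerated, and [x < y] implies [x <= z] for
    some [z] covered by [y], so that the covering relation, which mentions the
    length, is preserved by [f].  Both follow from the inversion cocycle
    [N x t], which the universal property of the presentation produces by
    lifting [s] to [(s, indicator of s)] in the group of pairs [(x, A)], where
    [W] acts on sign functions [A] by conjugation.  For a reflection [t],
    [N x t] holds iff [t x] is shorter than [x]; this gives the strong exchange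
    property. *)

Set Implicit Arguments.
Unset Strict Implicit.
Unset Printing Implicit Defensive.

(** * Semidirect product of [W] with the sign functions on [W] *)

Section SignedConjugation.
Local Open Scope group_scope.
Variable W : groupType.

Definition signedConj : Type := (W * (W -> bool))%type.

HB.instance Definition _ := Choice.on signedConj.

Definition signedConj_mul (a b : signedConj) : signedConj :=
  (a.1 * b.1, fun t => a.2 t (+) b.2 (t ^ a.1)).
Definition signedConj_one : signedConj := (1, fun=> false).
Definition signedConj_inv (a : signedConj) : signedConj :=
  (a.1^-1, fun t => a.2 (t ^ a.1^-1)).

Fact signedConj_mulA : associative signedConj_mul.
Proof.
move=> a b c; congr pair; first exact: mulgA.
by apply: funext => t /=; rewrite addbA conjgM.
Qed.

Fact signedConj_mul1g : left_id signedConj_one signedConj_mul.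
Proof.
move=> [x A]; congr pair; first exact: mul1g.
by apply: funext => t /=; rewrite conjg1.
Qed.

Fact signedConj_mulg1 : right_id signedConj_one signedConj_mul.
Proof.
move=> [x A]; congr pair; first exact: mulg1.
by apply: funext => t /=; rewrite addbF.
Qed.

Fact signedConj_mulVg :
  left_inverse signedConj_one signedConj_inv signedConj_mul.
Proof.
move=> [x A]; congr pair; first exact: mulVg.
by apply: funext => t /=; rewrite addbb.
Qed.

Fact signedConj_mulgV :
  right_inverse signedConj_one signedConj_inv signedConj_mul.
Proof.
move=> [x A]; congr pair; first exact: mulgV.
by apply: funext => t /=; rewrite conjgK addbb.
Qed.

HB.instance Definition _ := isGroup.Build signedConj signedConj_mulA
  signedConj_mul1g signedConj_mulg1 signedConj_mulVg signedConj_mulgV.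

Lemma signedConj_mulE (a b : signedConj) :
  a * b = (a.1 * b.1, fun t => a.2 t (+) b.2 (t ^ a.1)).
Proof. by []. Qed.

Definition signedGen (a : W) : signedConj := (a, fun t => t == a).

(* With [x = a b], the elements [x ^+ l * a] for [l < 2 k] list the
   reflections met along the alternating word [a b a b ...] of length [2 k];
   if [x ^+ k = 1] each of them occurs twice and the signs cancel. *)
Lemma signedGenM_expg (a b : W) (k : nat) : a * a = 1 -> b * b = 1 ->
  (signedGen a * signedGen b) ^+ k =
  ((a * b) ^+ k, fun t => \big[addb/false]_(l < k.*2) (t == (a * b) ^+ l * a)).
Proof.
move=> a2 b2; have aV : a^-1 = a by apply: mulg1_eq.
have bV : b^-1 = b by apply: mulg1_eq.
elim: k => [|k IHk].
  by congr pair; apply: funext => t; rewrite big_ord0.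
rewrite expgS IHk !signedConj_mulE /= -expgS; congr pair.
apply: funext => t; rewrite 2!big_ord_recl /= expg0 mul1g -addbA.
congr (_ (+) (_ (+) _)).
  rewrite expg1; apply/eqP/eqP => [<-|->].
    by rewrite conjgE aV !mulgA a2 mul1g -mulgA a2 mulg1.
  by rewrite conjgE aV -!mulgA a2 mulg1 mulgA a2 mul1g.
apply: eq_bigr => l _; rewrite /bump /= !add1n.
rewrite (can2_eq (conjgK _) (conjgKV _)) conjgE invgK; congr (_ == _).
by rewrite invgM aV bV expgS expgSr !mulgA.
Qed.

End SignedConjugation.

(** * The inversion cocycle and the strong exchange property *)

Section InversionCocycle.
Local Open Scope group_scope.
Variables (W : groupType) (C : coxeterSystem W).

Local Notation s := (@cox_s W C).
Local Notation len := (cox_length C).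
Local Notation refl := (reflection C).

Lemma cox_s_sqr i : s i * s i = 1.
Proof. by have := cox_rel i i; rewrite cox_m_diag expg1. Qed.

Lemma cox_sV i : (s i)^-1 = s i.
Proof. exact/mulg1_eq/cox_s_sqr. Qed.

Lemma cox_sK i : involutive ( *%g (s i)).
Proof. by move=> x; rewrite mulgA cox_s_sqr mul1g. Qed.

(** These rules make [N x t] the parity of the number of times [t] occurs among the elements
    [s_1 ... s_(j-1) s_j s_(j-1) ... s_1] read off any word [s_1 ... s_k] of [x]. *)
Definition inversion_cocycle (N : W -> W -> bool) : Prop :=
  (forall i t, N (s i) t = (t == s i)) /\
  (forall x y t, N (x * y) t = N x t (+) N y (t ^ x)).

Lemma inversion_cocycle_exists : exists N, inversion_cocycle N.
Proof.
have [|f fs] := @cox_univ W C (signedConj W) (fun i => signedGen (s i)).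
  move=> i j; rewrite signedGenM_expg ?cox_s_sqr // cox_rel.
  congr pair; apply: funext => t; rewrite -addnn big_split_ord /=.
  rewrite [X in _ (+) X](eq_bigr (fun l : 'I__ => t == (s i * s j) ^+ l * s i)).
    exact: addbb.
  by move=> l _; rewrite expgnDr cox_rel mul1g.
(* The first component of [f] is multiplicative and fixes the generators, so it is the identity; the
   second one is then a cocycle. *)
have f1 x : (f x).1 = x.
  have [r ->] := cox_gen C x; elim: r => [|i r IHr].
    rewrite big_nil; suff -> : f 1 = 1 by [].
    by apply: (mulgI (f 1)); rewrite -gmulfM !mulg1.
  by rewrite !big_cons gmulfM signedConj_mulE /= IHr fs.
exists (fun x => (f x).2); split=> [i t|x y t]; first by rewrite fs.
by rewrite gmulfM signedConj_mulE /= f1.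
Qed.

Lemma cox_length_le r : (len (\prod_(i <- r) s i) <= size r)%N.
Proof.
rewrite /cox_length; case: ex_minnP => k _; apply.
by apply/asboolP; exists r.
Qed.

Lemma reduced_expr_exists x : exists2 r : seq (cox_index C), is_expr x r & size r = len x.
Proof. by rewrite /cox_length; case: ex_minnP => k /asboolP. Qed.

Lemma reflection_sqr t : refl t -> t * t = 1.
Proof.
by move=> [x [i ->]]; rewrite !mulgA mulgVK -(mulgA x) cox_s_sqr mulg1 mulgV.
Qed.

Lemma reflectionJ t x : refl t -> refl (t ^ x).
Proof.
by move=> [y [i ->]]; exists (x^-1 * y), i; rewrite conjgE invgM invgK !mulgA.
Qed.

Lemma reflection_s i : refl (s i).
Proof. by exists 1, i; rewrite mul1g invg1 mulg1. Qed.

Section Cocycle.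
Variables (N : W -> W -> bool) (HN : inversion_cocycle N).

Let Ns i t : N (s i) t = (t == s i). Proof. by case: HN. Qed.
Let NM x y t : N (x * y) t = N x t (+) N y (t ^ x). Proof. by case: HN. Qed.

Let N1 t : N 1 t = false.
Proof. by have := NM 1 1 t; rewrite mulg1 conjg1 addbb. Qed.

(** Peel off letters, conjugating [t] by each: odd parity forces the conjugate to equal some letter,
    and multiplying by [t] cancels that letter. *)
Lemma cocycle_exchange t r : N (\prod_(i <- r) s i) t ->
  exists r1 i r2,
    r = r1 ++ i :: r2 /\ t * \prod_(i <- r) s i = \prod_(i <- r1 ++ r2) s i.
Proof.
elim: r t => [|i r IHr] t; first by rewrite big_nil N1.
rewrite big_cons NM Ns; case: eqP => [-> _|_ /IHr[r1 [j [r2 [-> tr]]]]].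
  by exists [::], i, r; rewrite cox_sK.
exists (i :: r1), j, r2; split=> //; rewrite [RHS]big_cons -tr conjgE cox_sV.
by rewrite !mulgA cox_s_sqr mul1g.
Qed.

(** For [t = x s x^-1], [N t t] is the sum of [N x t], [N s s] and [N x^-1 s]; the outer terms
    cancel by the cocycle rule for [x x^-1 = 1]. *)
Lemma cocycle_refl t : refl t -> N t t.
Proof.
move=> [x [i ->]]; rewrite !NM Ns.
have eJ : (x * s i * x^-1) ^ x = s i.
  by rewrite conjgE !mulgA mulVg mul1g mulgVK.
rewrite conjgM eJ conjgE mulKg eqxx.
have := NM x x^-1 (x * s i * x^-1); rewrite mulgV N1 eJ.
by case: (N x _); case: (N _ (s i)).
Qed.

Lemma cocycle_length t x : N x t -> (len (t * x) < len x)%N.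
Proof.
have [r -> <-] := reduced_expr_exists x.
move=> /cocycle_exchange[r1 [i [r2 [-> ->]]]].
by rewrite size_cat /= addnS ltnS -size_cat cox_length_le.
Qed.

Lemma cocycleE t x : refl t -> N x t = (len (t * x) < len x)%N.
Proof.
move=> tr; apply/idP/idP => [/cocycle_length//|]; apply: contraTT => Nxt.
(* As [N t t] holds, multiplying [x] by [t] flips the value at [t], so [cocycle_length] applies to
   [t * x] and gives the opposite inequality. *)
have : N (t * x) t by rewrite NM cocycle_refl // conjgE mulKg (negPf Nxt).
by move=> /cocycle_length; rewrite mulgA reflection_sqr // mul1g -leqNgt => /ltnW.
Qed.

End Cocycle.

Lemma strong_exchange t r : refl t ->
    (len (t * \prod_(i <- r) s i) < len (\prod_(i <- r) s i))%N ->
  exists r1 i r2,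
    r = r1 ++ i :: r2 /\ t * \prod_(i <- r) s i = \prod_(i <- r1 ++ r2) s i.
Proof.
have [N HN] := inversion_cocycle_exists.
by move=> tr; rewrite -(cocycleE HN) //; apply: cocycle_exchange.
Qed.

(** [N x t] and [N (t * x) t] are opposite, so by [cocycleE] exactly one of the two strict
    inequalities holds. *)
Lemma length_reflection_neq t x : refl t -> len (t * x) != len x.
Proof.
have [N HN] := inversion_cocycle_exists; move=> tr.
have := cocycleE HN x tr; have := cocycleE HN (t * x) tr.
rewrite (HN.2 t x t) (cocycle_refl HN tr) conjgE mulKg mulgA reflection_sqr //.
by rewrite mul1g; case: ltngtP => //; case: (N x t).
Qed.

Lemma length_reflection_sM t i x : refl t -> t != s i ->
  (len (t * (s i * x)) < len (s i * x))%N = (len (t ^ s i * x) < len x)%N.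
Proof.
have [N HN] := inversion_cocycle_exists; move=> tr ti.
rewrite -!(cocycleE HN) //; last exact: reflectionJ.
by rewrite HN.2 HN.1 (negPf ti).
Qed.

Lemma length_sM_le i x : (len (s i * x) <= (len x).+1)%N.
Proof.
have [r -> <-] := reduced_expr_exists x.
by have := cox_length_le (i :: r); rewrite big_cons.
Qed.

Lemma length_sM i x :
  len (s i * x) = (len x).+1 \/ len x = (len (s i * x)).+1.
Proof.
have := length_sM_le i x; have := length_sM_le i (s i * x); rewrite cox_sK.
have := length_reflection_neq x (reflection_s i).
by rewrite neq_ltn => /orP[h h' _|h _ h']; [right|left]; apply/eqP;
   rewrite eqn_leq h h'.
Qed.

End InversionCocycle.

(** * Chains, lifting and coatoms in the Bruhat order *)

Section BruhatChains.
Local Open Scope group_scope.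
Variables (W : groupType) (C : coxeterSystem W).

Local Notation s := (@cox_s W C).
Local Notation len := (cox_length C).
Local Notation refl := (reflection C).
Local Notation step := (bruhat_step C).
Local Notation le := (bruhat_le C).
Local Notation cov := (bruhat_cov C).

Lemma bruhat_refl x : le x x. Proof. exact: rt_refl. Qed.

Lemma bruhat_trans y x z : le x y -> le y z -> le x z.
Proof. exact: rt_trans. Qed.

Lemma bruhat_leVlt x y : le x y -> x = y \/ (len x < len y)%N.
Proof.
elim=> {x y} [x y [_ xy]|x|x y z _ [->|xy] _ [<-|yz]]; [by right|by left|..].
- by left.
- by right.
- by right.
- by right; apply: ltn_trans yz.
Qed.

Lemma bruhat_le_len x y : le x y -> (len x <= len y)%N.
Proof. by move=> /bruhat_leVlt[->//|/ltnW]. Qed.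

Lemma bruhat_le_eq x y : le x y -> (len y <= len x)%N -> x = y.
Proof. by move=> /bruhat_leVlt[//|]; rewrite ltnNge => /negP. Qed.

Lemma bruhat_anti x y : le x y -> le y x -> x = y.
Proof. by move=> xy /bruhat_le_len; apply: bruhat_le_eq. Qed.

(** Steps are defined by a reflection on the right, the cocycle compares lengths under reflections
    on the left; conjugating by [y] passes between the two. *)
Lemma bruhat_stepP x y :
  step x y <-> exists2 t, refl t & x = t * y /\ (len x < len y)%N.
Proof.
split=> [[xyr xy]|[t tr [-> xy]]].
  exists ((x^-1 * y) ^ y^-1); first exact: reflectionJ.
  split=> //; rewrite -[LHS]mulg1 -(reflection_sqr xyr) conjgE invgK.
  by rewrite !mulgA mulgV mul1g mulgVK.
split=> //; rewrite invgM -mulgA.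
rewrite (mulg1_eq (reflection_sqr tr)).
exact: reflectionJ.
Qed.

(** If [x = t * y], multiplying by [s i] conjugates [t]; by [length_reflection_sM] the step keeps
    its direction unless [t = s i]. *)
Lemma bruhat_step_sM i x y : step x y -> step (s i * x) (s i * y) \/ y = s i * x.
Proof.
move=> /bruhat_stepP[t tr [xE xy]].
have [ti|ti] := eqVneq (t ^ s i) (s i).
  right; rewrite xE; suff -> : t = s i by rewrite cox_sK.
  by apply: (conjg_inj (s i)); rewrite ti conjgE mulKg.
have t'r := reflectionJ (s i) tr.
left; apply/bruhat_stepP; exists (t ^ s i) => //; split.
  by rewrite xE conjgE cox_sV -!mulgA cox_sK.
have -> : s i * x = t ^ s i * (s i * y).
  by rewrite xE conjgE cox_sV -!mulgA cox_sK.
rewrite length_reflection_sM // -conjgM cox_s_sqr conjg1 -xE.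
exact: xy.
Qed.

(** Multiply a chain by [s i] step by step; a step that is itself multiplication by [s i] lands the
    new chain on the old one. *)
Lemma bruhat_sM i x y : le x y -> le (s i * x) (s i * y) \/ le (s i * x) y.
Proof.
move=> /clos_rt_rt1n_iff; elim=> {x y} [x|x y z xy /clos_rt_rt1n_iff yz IH].
  by left; apply: bruhat_refl.
case: (bruhat_step_sM i xy) => [sxy|<-]; last by right.
by case: IH => h; [left|right]; apply: bruhat_trans h; apply: rt_step.
Qed.

Lemma bruhat_step_s i x : (len x < len (s i * x))%N -> step x (s i * x).
Proof.
move=> h; apply/bruhat_stepP; exists (s i); first exact: reflection_s.
by rewrite cox_sK.
Qed.

Lemma bruhat_cov_step x y : step x y -> len y = (len x).+1 -> cov x y.
Proof.
move=> xy xyl; split=> //; split; first exact: rt_step.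
by move=> xyE; case: xy => _; rewrite xyE ltnn.
Qed.

Lemma bruhat_covW x y : cov x y -> le x y.
Proof. by case=> -[]. Qed.

Lemma bruhat_cov_is_step x y : cov x y -> step x y.
Proof.
move=> [[/clos_rt_rt1n_iff xy nxy] xyl].
case: xy nxy xyl => [//|a z xa /clos_rt_rt1n_iff az _ zl].
suff <- : a = z by [].
by apply: bruhat_le_eq => //; rewrite zl; case: xa.
Qed.

(* Induction on the length of [y = s y'], with [z'] a coatom of [y'] above
   [s x]: the lifting property puts [x] below [s z'], a coatom of [y], if
   [z' < s z'], and otherwise below [z'], hence below [y']. *)
Lemma bruhat_step_coatom x y : step x y -> exists2 z, le x z & cov z y.
Proof.
move: {2}(len y) (erefl (len y)) => k; elim: k x y => [|k IHk] x y yk xy.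
  by case: xy; rewrite yk.
have [r yE rk] := reduced_expr_exists C y.
case: r => [|i r] in yE rk; first by rewrite yk in rk.
rewrite /is_expr big_cons in yE; set y' := (\prod_(i <- r) _) in yE.
have y'k : len y' = k.
  apply/eqP; rewrite eqn_leq; apply/andP; split.
    by move: rk; rewrite yk => -[<-]; apply: cox_length_le.
  by have := length_sM_le i y'; rewrite -yE yk.
have y'y : cov y' y.
  apply: bruhat_cov_step; rewrite ?yk ?y'k //.
  by rewrite yE; apply: bruhat_step_s; rewrite -yE yk y'k.
have [xy'|xy'] : step (s i * x) y' \/ y' = x; last 1 first.
- by exists y' => //; rewrite xy'; apply: bruhat_refl.
- case: (bruhat_step_sM i xy); rewrite yE; last by move/mulgI; right.
  by rewrite cox_sK; left.
have [z' xz' z'y'] := IHk _ _ y'k xy'.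
have z'k : k = (len z').+1 by rewrite -y'k; case: z'y'.
have xz'y' : le x z' -> exists2 z, le x z & cov z y.
  move=> xlez'; exists y' => //; apply: bruhat_trans xlez' _.
  exact: bruhat_covW.
case: (bruhat_sM i xz'); rewrite cox_sK // => h.
case: (length_sM i z') => z'l; last first.
  apply/xz'y'/(bruhat_trans h); rewrite -[X in le _ X](cox_sK i).
  by apply/rt_step/bruhat_step_s; rewrite cox_sK z'l.
exists (s i * z') => //; apply: bruhat_cov_step; last by rewrite yk z'l z'k.
(* The alternative [y' = s i * z'] would give [y = z'], which is too short. *)
case: (bruhat_step_sM i (bruhat_cov_is_step z'y')); rewrite -?yE // => y'E.
by move: yk; rewrite yE y'E cox_sK z'k => /eqP; rewrite ltn_eqF // ltnW.
Qed.

Lemma bruhat_lt_coatom x y : bruhat_lt C x y -> exists2 z, le x z & cov z y.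
Proof.
move=> [/clos_rt_rtn1_iff xy]; case: xy => [//|a z az /clos_rt_rtn1_iff xa _].
have [b ab bz] := bruhat_step_coatom az.
by exists b => //; apply: bruhat_trans ab.
Qed.

(** By strong exchange every coatom arises by deleting one letter from a fixed word of [v], so all
    coatoms lie in the finite list [del]. *)
Lemma coatom_enum_exists u v : exists m (c : 'I_m -> W), coatom_enum C u v c.
Proof.
have [r vE rk] := reduced_expr_exists C v.
pose del := [seq \prod_(i <- take k r ++ drop k.+1 r) s i | k <- iota 0 (size r)].
pose l := undup [seq w <- del | `[< coatoms C u v w >]].
have lP w : coatoms C u v w <-> w \in l.
  rewrite mem_undup mem_filter; split=> [cw|/andP[/asboolP//]].
  apply/andP; split; first exact/asboolP.
  case: cw => _ /bruhat_cov_is_step/bruhat_stepP[t tr [wE]].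
  rewrite wE vE => /(strong_exchange tr)[r1 [i [r2 [rE ->]]]].
  apply/mapP; exists (size r1).
    by rewrite mem_iota rE size_cat /= add0n addnS ltnS leq_addr.
  by rewrite rE take_size_cat // -cat_rcons drop_size_cat // size_rcons.
exists (size l), (tnth (in_tuple l)); split=> [i _|i j _ _|w /lP wl].
- exact/lP/mem_tnth.
- exact/tuple_uniqP/undup_uniq.
- by have /tnthP[i ->] : w \in in_tuple l by []; exists i.
Qed.

End BruhatChains.

(** * Isomorphisms of Bruhat intervals *)

Section BruhatIsomorphisms.
Variables (W : groupType) (C : coxeterSystem W).

Local Notation le := (bruhat_le C).
Local Notation itv := (itv C).
Local Notation iso := (poset_iso C).

Lemma poset_iso_homo A B f a : iso A B f -> A a -> B (f a).
Proof. by case=> -[Bf _ _] _; apply: Bf. Qed.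

Lemma poset_iso_inj A B f a b : iso A B f -> A a -> A b -> f a = f b -> a = b.
Proof. by case=> -[_ fI _] _ Aa Ab; apply: fI; rewrite inE. Qed.

Lemma poset_iso_surj A B f b : iso A B f -> B b -> exists2 a, A a & f a = b.
Proof. by case=> -[_ _ fS] _ /fS[a]; exists a. Qed.

Lemma poset_iso_le A B f a b : iso A B f -> A a -> A b ->
  le a b <-> le (f a) (f b).
Proof. by case=> _; apply. Qed.

Lemma poset_iso_comp A B E f g : iso A B f -> iso B E g -> iso A E (g \o f).
Proof.
move=> fP gP; split; last first.
  move=> a b Aa Ab; rewrite (poset_iso_le fP Aa Ab).
  exact: (poset_iso_le gP (poset_iso_homo fP Aa) (poset_iso_homo fP Ab)).
split=> [a Aa|a b|e Ee].
- exact/(poset_iso_homo gP)/(poset_iso_homo fP).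
- rewrite !inE => Aa Ab /(poset_iso_inj gP) => h; apply: (poset_iso_inj fP) => //.
  by apply: h; apply: (poset_iso_homo fP).
- have [b Bb <-] := poset_iso_surj gP Ee.
  by have [a Aa <-] := poset_iso_surj fP Bb; exists a.
Qed.

(** Carrying both maps lets the two intervals be exchanged, so that each equality below needs only
    one inclusion argument. *)
Definition inverse_isos (A B : set W) (f g : W -> W) : Prop :=
  [/\ iso A B f, iso B A g, (forall a, A a -> g (f a) = a) &
      (forall b, B b -> f (g b) = b)].

Lemma inverse_isosC A B f g : inverse_isos A B f g -> inverse_isos B A g f.
Proof. by case=> *; split. Qed.

Lemma poset_iso_inverse A B f : iso A B f -> exists g, inverse_isos A B f g.
Proof.
move=> fP; have /choice[g gP] b : exists a, B b -> A a /\ f a = b.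
  have [/(poset_iso_surj fP)[a Aa fa]|nBb] := pselect (B b).
    by exists a.
  (* Off [B] the condition is void, and [b] is a default value. *)
  by exists b.
have gf a : A a -> g (f a) = a.
  move=> Aa; have [Agfa fgfa] := gP _ (poset_iso_homo fP Aa).
  exact: (poset_iso_inj fP).
exists g; split=> //; last by move=> b /gP[].
split; last first.
  move=> a b /gP[Aga fga] /gP[Agb fgb].
  by rewrite -{1}fga -{1}fgb (poset_iso_le fP Aga Agb).
split=> [b /gP[]//|a b|a Aa].
- by rewrite !inE => /gP[_ {2}<-] /gP[_ {2}<-] ->.
- by exists (f a); [apply: (poset_iso_homo fP)|apply: gf].
Qed.

Section Interval.
Variables (u v u' v' : W) (f : W -> W).
Hypotheses (uv : le u v) (uv' : le u' v') (fP : iso (itv u v) (itv u' v') f).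

Let uI : itv u v u. Proof. by split=> //; apply: bruhat_refl. Qed.
Let vI : itv u v v. Proof. by split=> //; apply: bruhat_refl. Qed.

Lemma itv_iso_bot : f u = u'.
Proof.
have [a Ia fa] : exists2 a, itv u v a & f a = u'.
  by apply: (poset_iso_surj fP); split=> //; apply: bruhat_refl.
have [u'fu _] := poset_iso_homo fP uI.
apply: (fun h => bruhat_anti h u'fu); rewrite -fa.
by apply/(poset_iso_le fP uI Ia); case: Ia.
Qed.

Lemma itv_iso_top : f v = v'.
Proof.
have [a Ia fa] : exists2 a, itv u v a & f a = v'.
  by apply: (poset_iso_surj fP); split=> //; apply: bruhat_refl.
have [_ fvv'] := poset_iso_homo fP vI.
apply: (bruhat_anti fvv'); rewrite -fa.
by apply/(poset_iso_le fP Ia vI); case: Ia.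
Qed.

Lemma itv_iso_restr w : itv u v w -> iso (itv u w) (itv u' (f w)) f.
Proof.
move=> Iw; have sub x : itv u w x -> itv u v x.
  by case: Iw => _ wv [ux xw]; split=> //; apply: bruhat_trans wv.
have fw := poset_iso_homo fP Iw.
split; last by move=> a b /sub Ia /sub Ib; apply: (poset_iso_le fP).
split=> [a Ia|a b|b [u'b bfw]].
- split; first by have [] := poset_iso_homo fP (sub _ Ia).
  by apply/(poset_iso_le fP (sub _ Ia) Iw); case: Ia.
- by rewrite !inE => /sub Ia /sub Ib; apply: (poset_iso_inj fP).
- have [|a Ia fa] := poset_iso_surj fP (b := b).
    by split=> //; apply: bruhat_trans bfw _; case: fw.
  exists a => //; split; first by case: Ia.
  by apply/(poset_iso_le fP Ia Iw); rewrite fa.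
Qed.

(* The covering relation, although defined through the length, is an invariant
   of the order: this is where gradedness of the Bruhat order enters. *)
Lemma itv_iso_cov a b : itv u v a -> itv u v b ->
  bruhat_cov C a b -> bruhat_cov C (f a) (f b).
Proof.
move=> Ia Ib [[ab nab] bl].
have [u'fa _] := poset_iso_homo fP Ia.
have [_ fbv'] := poset_iso_homo fP Ib.
(* A coatom [z] of [f b] above [f a] pulls back to [d] with [a <= d < b]; lengths force [d = a], so
   [z = f a]. *)
have [|z faz zfb] := @bruhat_lt_coatom _ C (f a) (f b).
  split; first exact/(poset_iso_le fP Ia Ib).
  by move=> /(poset_iso_inj fP Ia Ib).
have Iz : itv u' v' z.
  split; first exact: bruhat_trans faz.
  by apply: bruhat_trans fbv'; apply: bruhat_covW.
have [d Id fd] := poset_iso_surj fP Iz.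
suff -> : a = d by rewrite fd.
have ad : le a d by apply/(poset_iso_le fP Ia Id); rewrite fd.
have db : le d b by apply/(poset_iso_le fP Id Ib); rewrite fd; apply: bruhat_covW.
apply: (bruhat_le_eq ad); rewrite -ltnS -bl.
case: (bruhat_leVlt db) => // dbE.
by case: zfb => -[_]; rewrite -fd dbE.
Qed.

Lemma coatoms_itv w : coatoms C u v w -> itv u v w.
Proof. by case=> -[uw _] /bruhat_covW. Qed.

Lemma itv_iso_coatoms w : coatoms C u v w -> coatoms C u' v' (f w).
Proof.
move=> cw; have Iw := coatoms_itv cw; case: cw => -[_ nuw] wv.
split; last by rewrite -itv_iso_top; apply: itv_iso_cov.
split; first by have [] := poset_iso_homo fP Iw.
by rewrite -itv_iso_bot => /(poset_iso_inj fP uI Iw).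
Qed.

End Interval.

Lemma coatom_enum_iso u v u' v' f m (c : 'I_m -> W) :
    le u v -> le u' v' -> iso (itv u v) (itv u' v') f ->
  coatom_enum C u v c -> coatom_enum C u' v' (f \o c).
Proof.
move=> uv uv' fP [ch ci cs]; have [g [_ gP gf fg]] := poset_iso_inverse fP.
split=> [i _|i j _ _ /= fc|w' cw'].
- by apply: (itv_iso_coatoms uv uv' fP); apply: ch.
- apply: ci; rewrite ?inE //.
  by apply: (poset_iso_inj fP) fc; apply: coatoms_itv; apply: ch.
- have [i _ ciE] := cs _ (itv_iso_coatoms uv' uv gP cw').
  by exists i => //=; rewrite ciE fg //; apply: coatoms_itv.
Qed.

End BruhatIsomorphisms.

(** * Transport of [TPA] along an isomorphism *)

Section TpaInvariance.
Variables (W : groupType) (C : coxeterSystem W) (n : nat) (D : tpaData C n).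

Local Notation le := (bruhat_le C).
Local Notation itv := (itv C).
Local Notation iso := (poset_iso C).
Local Notation cov := (bruhat_cov C).

Lemma rep_of_iso k x y x' y' f : (k < n)%N -> is_itv C k x y ->
    is_itv C k x' y' -> iso (itv x y) (itv x' y') f ->
  rep_of D k x y = rep_of D k x' y'.
Proof.
move=> kn xy xy' fP; have [p [[pr [g gP]] pu]] := reps_uniq D kn xy'.
have xyp : reps D k p /\ poset_isomorphic C (itv x y) (itv p.1 p.2).
  by split=> //; exists (g \o f); apply: poset_iso_comp gP.
have [q [_ qu]] := reps_uniq D kn xy.
rewrite /rep_of (@xget_unique _ _ _ p) //; last first.
  by move=> r rP; rewrite -(qu _ rP); apply: qu.
rewrite (@xget_unique _ _ _ p) //; first by split=> //; exists g.
by move=> r rP; rewrite -(pu _ rP).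
Qed.

(** Composing with [f] makes the target of [phi D x' y'] a representative of [[x, y]] too, so
    uniqueness identifies both targets. *)
Lemma phi_iso_common k x y x' y' f : (k < n)%N -> is_itv C k x y ->
    is_itv C k x' y' -> iso (itv x y) (itv x' y') f ->
  exists2 B, iso (itv x y) B (phi D x y) & iso (itv x' y') B (phi D x' y').
Proof.
move=> kn xy xy' fP; have [p pr pP] := phi_iso D kn xy.
have [p' pr' pP'] := phi_iso D kn xy'.
have [q [_ qu]] := reps_uniq D kn xy.
suff pp' : p = p' by exists (itv p.1 p.2); rewrite // pp'.
transitivity q; last apply: qu.
  by apply/esym/qu; split=> //; exists (phi D x y).
by split=> //; exists (phi D x' y' \o f); apply: poset_iso_comp pP'.
Qed.

Lemma coatom_is_itv u v w : (0 < n)%N -> is_itv C n u v -> coatoms C u v w ->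
  is_itv C n.-1 u w.
Proof.
move=> hn [_ vl] [[uw _] [_ wl]]; split=> //; apply: eq_add_S.
by rewrite -wl -addnS prednK.
Qed.

Definition matched m (f : W -> W) u (c : 'I_m -> W) psi u' (c' : 'I_m -> W) psi' :=
  forall i x, itv u (c i) x -> Theta D u' c' psi' i (f x) = Theta D u c psi i x.

Section Pair.
Variables (u v u' v' : W) (f g : W -> W) (m : nat) (c c' : 'I_m -> W).
Hypotheses (huv : is_itv C n u v) (huv' : is_itv C n u' v').
Hypotheses (fgP : inverse_isos C (itv u v) (itv u' v') f g).
Hypotheses (cP : forall i, coatoms C u v (c i)) (c'E : forall i, c' i = f (c i)).

Let uv : le u v. Proof. by case: huv. Qed.
Let uv' : le u' v'. Proof. by case: huv'. Qed.
Let fP : iso (itv u v) (itv u' v') f. Proof. by case: fgP. Qed.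
Let cI i : itv u v (c i). Proof. exact: coatoms_itv. Qed.
Let fu : f u = u'. Proof. exact: itv_iso_bot fP. Qed.

Lemma matched_sym psi psi' :
  matched f u c psi u' c' psi' -> matched g u' c' psi' u c psi.
Proof.
move=> fM i x'; rewrite c'E => Ix'.
have [x Ix <-] := poset_iso_surj (itv_iso_restr fP (cI i)) Ix'.
have [_ _ gf _] := fgP; rewrite fM // gf //.
by case: Ix (cI i) => ux xc [_ cv]; split=> //; apply: bruhat_trans cv.
Qed.

(** The outer [phi] graphs coincide since [Theta] takes the same values at the end points; inside,
    the intermediate point [x] of [[u, w]] is replaced by [f x]. *)
Lemma tau_sub psi psi' i j w : matched f u c psi u' c' psi' ->
    itv u v w -> le w (c i) -> le w (c j) ->
  (tau D u c psi i j w `<=` tau D u' c' psi' i j (f w))%classic.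
Proof.
move=> fM Iw wi wj; have [uw _] := Iw.
have M k x : le w (c k) -> itv u w x ->
    Theta D u' c' psi' k (f x) = Theta D u c psi k x.
  by move=> wk [ux xw]; apply: fM; split=> //; apply: bruhat_trans wk.
have uI : itv u w u by split=> //; apply: bruhat_refl.
have wI : itv u w w by split=> //; apply: bruhat_refl.
have Mu k : le w (c k) -> Theta D u' c' psi' k u' = Theta D u c psi k u.
  by move=> wk; rewrite -[X in Theta _ _ _ _ _ X]fu M.
rewrite /tau !Mu // !M // => -[a b] /= [d [x [e he [/= Ix ex]] [/= Ix' dx]] hd].
exists d => //; exists (f x); last first.
  split=> /=; last by rewrite M.
  exact: (poset_iso_homo (itv_iso_restr fP Iw)).
exists e => //; split=> /=; last by rewrite M.
exact: (poset_iso_homo (itv_iso_restr fP Iw)).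
Qed.

Let cov_itv i w : itv u v w -> cov w (c i) -> itv u (c i) w.
Proof. by case=> uw _ /bruhat_covW. Qed.

Lemma P_set_sub psi psi' : matched f u c psi u' c' psi' ->
  (P_set D u v c psi `<=` P_set D u' v' c' psi')%classic.
Proof.
move=> fM q [i [j [w [ij Iw wi wj ->]]]]; exists i, j, (f w).
rewrite !c'E !fM; try exact: cov_itv.
by split=> //; [apply: (poset_iso_homo fP)|apply: (itv_iso_cov fP)..].
Qed.

(** The graph of [tau] is a component of each element of [A_set], so the inclusion of graphs from
    [tau_sub] is not enough and equality is assumed. *)
Lemma A_set_sub psi psi' : matched f u c psi u' c' psi' ->
    (forall i j w, itv u v w -> cov w (c i) -> cov w (c j) ->
       tau D u c psi i j w = tau D u' c' psi' i j (f w)) ->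
  (A_set D u v c psi `<=` A_set D u' v' c' psi')%classic.
Proof.
move=> fM tauE q [i [j [w [Iw wi ji wj ->]]]]; exists i, j, (f w).
rewrite !c'E !fM; try exact: cov_itv.
split=> //; [exact: (poset_iso_homo fP)|exact: (itv_iso_cov fP)..|].
by rewrite tauE.
Qed.

Hypothesis hn : (0 < n)%N.

(** Solve the matching condition for [psi' i]: it is [Theta i] between the inverse [h] of [f] and
    the inverse [k] of the second [phi], which is legitimate because both [phi] have the same
    target. *)
Lemma matched_psi_exists psi : (forall i, is_itv C n.-1 u' (c' i)) ->
    aut_tuple C u c psi ->
  exists2 psi', aut_tuple C u' c' psi' & matched f u c psi u' c' psi'.
Proof.
have n1 : (n.-1 < n)%N by rewrite prednK.
move=> c'I psiP; pose good i psi'i := poset_aut C (itv u' (c' i)) psi'i /\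
  forall x, itv u (c i) x -> phi D u' (c' i) (psi'i (f x)) = Theta D u c psi i x.
have /choice[psi' psi'P] i : exists psi'i, good i psi'i.
  have fi : iso (itv u (c i)) (itv u' (c' i)) f.
    by rewrite c'E; apply: (itv_iso_restr fP).
  have [h [_ hP hf _]] := poset_iso_inverse fi.
  have [B phiP phiP'] := phi_iso_common n1 (coatom_is_itv hn huv (cP i)) (c'I i) fi.
  have [k [_ kP _ phik]] := poset_iso_inverse phiP'.
  have ThetaP : iso (itv u (c i)) B (Theta D u c psi i).
    exact: (poset_iso_comp (psiP i) phiP).
  exists (k \o (Theta D u c psi i \o h)); split.
    exact: (poset_iso_comp (poset_iso_comp hP ThetaP) kP).
  by move=> x Ix /=; rewrite hf // phik //; apply: (poset_iso_homo ThetaP).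
by exists psi' => i => [|x Ix]; have [+ +] := psi'P i => // _; apply.
Qed.

End Pair.

Lemma TPA_sub u v u' v' f g m (c c' : 'I_m -> W) : (0 < n)%N ->
    is_itv C n u v -> is_itv C n u' v' ->
    inverse_isos C (itv u v) (itv u' v') f g ->
    (forall i, coatoms C u v (c i)) -> (forall i, coatoms C u' v' (c' i)) ->
    (forall i, c' i = f (c i)) ->
  (TPA D u v c `<=` TPA D u' v' c')%classic.
Proof.
move=> hn huv huv' fgP cP cP' c'E q [psi psiP ->].
have [fP gP gf fg] := fgP; have gfP := inverse_isosC fgP.
have cE i : c i = g (c' i) by rewrite c'E gf //; apply: coatoms_itv.
have c'I i := coatom_is_itv hn huv' (cP' i).
have cI i := coatom_is_itv hn huv (cP i).
have [psi' psi'P fM] := matched_psi_exists huv fgP cP c'E hn c'I psiP.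
have gM := matched_sym fgP cP c'E fM.
have tauE i j w : itv u v w -> cov w (c i) -> cov w (c j) ->
    tau D u c psi i j w = tau D u' c' psi' i j (f w).
  move=> Iw wi wj; apply/seteqP; split.
    by apply: (tau_sub huv huv' fgP) => //; apply: bruhat_covW.
  have If k : cov w (c k) -> le (f w) (c' k).
    move=> wk; rewrite c'E; apply/bruhat_covW/(itv_iso_cov fP) => //.
    exact: coatoms_itv.
  (* Writing [w] as [g (f w)] turns the reverse inclusion into [tau_sub] for the exchanged
     intervals. *)
  rewrite -{2}(gf w Iw); apply: (tau_sub huv' huv gfP) => //; try exact: If.
  exact: (poset_iso_homo fP).
exists psi' => //; congr (_, _, _).
- apply: eq_map => i; congr (num _ _ _).
  apply: (rep_of_iso _ (cI i) (c'I i)); first by rewrite prednK.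
  by rewrite c'E; apply: (itv_iso_restr fP); apply: coatoms_itv.
- apply/seteqP; split; first exact: (P_set_sub fgP cP c'E fM).
  exact: (P_set_sub gfP cP' cE gM).
- apply/seteqP; split; first exact: (A_set_sub fgP cP c'E fM).
  apply: (A_set_sub gfP cP' cE gM) => i j w Iw wi wj.
  have cov_g k : cov w (c' k) -> cov (g w) (c k).
    by move=> wk; rewrite cE; apply: (itv_iso_cov gP) => //; apply: coatoms_itv.
  rewrite tauE ?fg //; [exact: (poset_iso_homo gP)|exact: cov_g..].
Qed.

End TpaInvariance.

Theorem theorem4 (W : groupType) (C : coxeterSystem W) (n : nat)
    (hn : (1 <= n)%N) (D : tpaData C n) (u v u' v' : W)
    (huv : is_itv C n u v) (huv' : is_itv C n u' v')
    (hiso : poset_isomorphic C (itv C u v) (itv C u' v')) :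
  exists (m : nat) (c : 'I_m -> W) (m' : nat) (c' : 'I_m' -> W),
    [/\ coatom_enum C u v c, coatom_enum C u' v' c' &
        TPA D u v c = TPA D u' v' c'].
Proof.
have [f fP] := hiso; have [g fgP] := poset_iso_inverse fP.
have [uv _] := huv; have [uv' _] := huv'; have [_ _ gf _] := fgP.
have [m [c cP]] := coatom_enum_exists C u v.
have cP' := coatom_enum_iso uv uv' fP cP.
have cC i : coatoms C u v (c i) by case: cP => + _ _; apply.
have cC' i : coatoms C u' v' ((f \o c) i) by case: cP' => + _ _; apply.
exists m, c, m, (f \o c); split=> //; apply/seteqP; split.
  exact: (TPA_sub hn huv huv' fgP).
apply: (TPA_sub hn huv' huv (inverse_isosC fgP)) => // i.
by rewrite /= gf //; apply: coatoms_itv.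
Qed.
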